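(* For every integer $n\ge 3$, $$\big\lceil (\varphi+1)n -2\varphi\big\rceil\le \tilde{r}(C_3,P_n)\le 3n-4,$$ where $\varphi=(1+\sqrt5)/2$ is the golden ratio.
   Context: In the online size Ramsey game $\mathcal R(H_1,H_2)$, played on the edge set of the infinite complete graph $K_{\mathbb N}$, in each round Builder selects a previously unselected edge and Painter colours it red or blue; the game ends as soon as there is a red copy of $H_1$ or a blue copy of $H_2$. Builder tries to end the game as soon as possible, Painter tries to delay it, and $\tilde r(H_1,H_2)$ is the number of rounds under optimal play of both players. $C_3$ is the triangle and $P_n$ is the path on $n$ vertices. *)

(* Defs.v *)
From mathcomp Require Import all_boot all_order all_algebra.
From mathcomp Require Import reals.
Set Implicit Arguments. Unset Strict Implicit. Unset Printing Implicit Defensive.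
Import Order.TTheory GRing.Theory Num.Theory.

(* The online size Ramsey game R(C_3, P_n) on K_N (vertex set nat).
   A position is the list of selected edges so far, each with its colour:
   ((u, v), true) = edge uv coloured red, ((u, v), false) = coloured blue.
   Edges are unordered: (u,v) and (v,u) denote the same edge. *)
Definition position := seq ((nat * nat) * bool).

Definition same_edge (e : nat * nat) (u v : nat) : bool :=
  ((e.1 == u) && (e.2 == v)) || ((e.1 == v) && (e.2 == u)).

Definition selected (p : position) (u v : nat) : bool :=
  has (fun t => same_edge t.1 u v) p.

Definition coloured (c : bool) (p : position) (u v : nat) : bool :=
  has (fun t => same_edge t.1 u v && (t.2 == c)) p.

Definition red := coloured true.
Definition blue := coloured false.

Definition has_red_triangle (p : position) : Prop :=
  exists a b c : nat, [/\ a != b, b != c, a != c &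
    [&& red p a b, red p b c & red p a c]].

Definition has_blue_path (n : nat) (p : position) : Prop :=
  exists (x : nat) (t : seq nat),
    [/\ size (x :: t) = n, uniq (x :: t) & path (blue p) x t].

Definition game_over (n : nat) (p : position) : Prop :=
  has_red_triangle p \/ has_blue_path n p.

Fixpoint builder_wins (n k : nat) (p : position) : Prop :=
  game_over n p \/
  match k with
  | 0 => False
  | k'.+1 => exists u v : nat, u <> v /\ ~~ selected p u v /\
       forall c : bool, builder_wins n k' (((u, v), c) :: p)
  end.

Definition online_ramsey_le (n k : nat) : Prop := builder_wins n k [::].

Definition golden_ratio (R : realType) : R := (1 + Num.sqrt 5) / 2.

(* Main.v *)
Require Import Defs.
From mathcomp Require Import all_boot all_order all_algebra.
From mathcomp Require Import reals zify ring lra.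
Set Implicit Arguments. Unset Strict Implicit. Unset Printing Implicit Defensive.
Import Order.TTheory GRing.Theory Num.Theory.

(** Lower bound. Painter keeps a bipartition of every component of the graph of
    selected edges: an edge inside a component is red if and only if it joins
    the two sides, so red odd cycles never appear and blue paths stay on one
    side. When Builder joins two components, either colour is possible and
    determines how the sides are glued. Give a side with [a] vertices the weight
    [m + 1 - phi * a], where [m] counts the edges of the component that are not
    blue edges inside that side. Red gluing adds the weights of the sides that
    are identified, blue gluing does the same and loses 1 on one side; since
    [phi ^ 2 = phi + 1], one of the two choices always keeps both weights at
    least [2 - 2 * phi], which is the claimed bound for a blue path on a side.

    Upper bound. Builder grows two disjoint blue paths [P] and [Q] whose first
    vertices [x], [e] are joined by a red edge. A new vertex [z] is joined to
    the last vertex of [P]: blue lengthens [P] in one round; after red, [z] is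
    joined to [Q], and blue lengthens [Q] in two rounds, while red forces blue
    edges that merge [P] and [Q] into one long path, which then plays the role
    of [Q]. Thus [P] costs one round per vertex and [Q] two, so that about [3n]
    rounds suffice for one of them to reach [n] vertices. *)

(** * Builder *)

Arguments builder_wins : simpl never.

Lemma same_edgeC e u v : same_edge e u v = same_edge e v u.
Proof. by rewrite /same_edge orbC. Qed.

Lemma colouredC c p u v : coloured c p u v = coloured c p v u.
Proof. by apply: eq_has => t; rewrite same_edgeC. Qed.

(** Positions are compared through their coloured edges only, so that a position extends itself when
    Builder skips a round on an already coloured edge. *)
Definition extends (p q : position) :=
  forall c u v, coloured c p u v -> coloured c q u v.

Lemma extends_trans p q r : extends p q -> extends q r -> extends p r.
Proof. by move=> h1 h2 c u v /h1/h2. Qed.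

Lemma extends_cons t p : extends p (t :: p).
Proof. by move=> c u v h; rewrite /coloured /= -/(coloured c p u v) h orbT. Qed.

Lemma coloured_head c p u v : coloured c (((u, v), c) :: p) u v.
Proof. by rewrite /coloured /= /same_edge /= !eqxx. Qed.

Lemma extends_path p q x s :
  extends p q -> path (blue p) x s -> path (blue q) x s.
Proof. by move=> h; apply: sub_path => u v; apply: h. Qed.

Lemma selected_coloured p u v : selected p u v -> exists c, coloured c p u v.
Proof.
by move=> /hasP[t tp h]; exists t.2; apply/hasP; exists t => //; rewrite h eqxx.
Qed.

Lemma builder_wins_over n k p : game_over n p -> builder_wins n k p.
Proof. by case: k => [|k] h; left. Qed.

Lemma builder_winsS n k p : builder_wins n k p -> builder_wins n k.+1 p.
Proof.
elim: k p => [|k IH] p; first by case=> // h; left.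
case=> [h|[u [v [uv [sel h]]]]]; first by left.
by right; exists u, v; split=> //; split=> // c; apply: IH; apply: h.
Qed.

(* If [u v] is already coloured, Builder uses the colour and saves the round. *)
Lemma builder_plays n k p u v : u != v ->
  (forall q, extends p q -> red q u v -> builder_wins n k q) ->
  (forall q, extends p q -> blue q u v -> builder_wins n k q) ->
  builder_wins n k.+1 p.
Proof.
move=> uv hr hb.
have h c : builder_wins n k (((u, v), c) :: p).
  by case: c; [apply: hr|apply: hb]; try exact: extends_cons; apply: coloured_head.
have [sel|nsel] := boolP (selected p u v); last first.
  by right; exists u, v; split; [exact/eqP|split].
have [c cp] := selected_coloured sel; apply: builder_winsS.
by case: c cp => cp; [apply: hr|apply: hb].
Qed.

Lemma red_triangle n k p a b c : a != b -> b != c -> a != c ->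
  red p a b -> red p b c -> red p a c -> builder_wins n k p.
Proof.
move=> ab bc ac r1 r2 r3; apply: builder_wins_over; left.
by exists a, b, c; split=> //; apply/and3P.
Qed.

(* Painter cannot colour [c d] red without closing a red triangle. *)
Definition forceable p c d := exists w,
  [/\ w != c, w != d, red p w c & red p w d].

Lemma forceable_extends p q c d :
  extends p q -> forceable p c d -> forceable q c d.
Proof. by move=> h [w [wc wd r1 r2]]; exists w; split=> //; apply: h. Qed.

Lemma builder_forces n k p c d : c != d -> forceable p c d ->
  (forall q, extends p q -> blue q c d -> builder_wins n k q) ->
  builder_wins n k.+1 p.
Proof.
move=> cd [w [wc wd r1 r2]] h; apply: (builder_plays cd) => // q pq r.
by apply: (@red_triangle _ _ _ w c d) => //; apply: pq.
Qed.

Lemma blue_path_wins n k p x s : path (blue p) x s -> uniq (x :: s) ->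
  0 < n <= size (x :: s) -> builder_wins n k p.
Proof.
case: n => // n ps us /= ns; apply: builder_wins_over; right.
exists x, (take n s); split; first by rewrite /= size_takel.
  by have := take_uniq n.+1 us.
by have := take_path n ps.
Qed.

Lemma blue_path_rev p x s : path (blue p) x s -> exists s',
  [/\ path (blue p) (last x s) s', last (last x s) s' = x
    & perm_eq (last x s :: s') (x :: s)].
Proof.
move=> ps; exists (rev (belast x s)); split.
- by rewrite rev_path; apply: sub_path ps => u v; rewrite /blue colouredC.
- by case: s {ps} => //= y s; rewrite rev_cons last_rcons.
- by rewrite -rev_rcons perm_rev -lastI.
Qed.

Lemma fresh_vertex (s : seq nat) : exists z, z \notin s.
Proof.
exists (\max_(i <- s) i).+1; apply/negP => /(@leq_bigmax_seq _ _ xpredT id) /=.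
by rewrite ltnn => /(_ isT).
Qed.

(** * The race between two blue paths *)

Ltac perm_count := apply/permP => ?; clear;
  rewrite -?cats1 /= ?count_cat /= ?count_cat /=; lia.

(* In the three predicates below, the last inequality says that [k] is at least
   [3 * n - 4] minus the cost accounted for so far: one round per vertex of [P],
   two per vertex of [Q], minus 3. A lone path counts as [Q]. *)
Definition plain_wins n k := forall p x s,
  path (blue p) x s -> uniq (x :: s) ->
  3 * n <= k + 2 * size (x :: s) + 1 -> builder_wins n k p.

(* [e :: t] and [u] are blue paths that one forced blue edge links together.
   Postponing this edge saves one round whenever [P] wins the race. *)
Definition gap p e t u :=
  if u is d :: u' then forceable p (last e t) d /\ path (blue p) d u' else True.

Definition locked_wins n k := forall p x s e t u,
  path (blue p) x s -> path (blue p) e t -> gap p e t u ->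
  uniq ((x :: s) ++ (e :: t) ++ u) -> red p x e ->
  size (x :: s) < n -> size ((e :: t) ++ u) < n ->
  3 * n <= k + size (x :: s) + 2 * size ((e :: t) ++ u) + 1 ->
  builder_wins n k p.

(* [z] is red to both sides of the gap, so any red neighbour of [z] can be
   inserted into the gap, and a blue neighbour of [z] extends the path. *)
Definition insert_wins n k := forall p z s d u,
  path (blue p) z s -> path (blue p) d u -> uniq ((z :: s) ++ d :: u) ->
  s <> [::] -> red p z (last z s) -> red p z d -> 0 < k ->
  3 * n <= k + 2 * size ((z :: s) ++ d :: u) + 1 -> builder_wins n k p.

Lemma gap_extends p q e t u : extends p q -> gap p e t u -> gap q e t u.
Proof.
case: u => // d u pq [/(forceable_extends pq) f] /(extends_path pq) pu.
by split.
Qed.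

Lemma builder_closes_gap n k p e t u : path (blue p) e t -> gap p e t u ->
  uniq ((e :: t) ++ u) ->
  (forall q, extends p q -> path (blue q) e (t ++ u) -> builder_wins n k q) ->
  builder_wins n k.+1 p.
Proof.
case: u => [|d u] pe; first by move=> _ _ h; apply/builder_winsS/h => //; rewrite cats0.
move=> [f pu] un h; apply: (builder_forces _ f) => [|q pq b].
  apply/eqP => ed; move: un; rewrite cat_uniq => /and3P[_ /hasPn/(_ d)].
  by rewrite inE eqxx -ed mem_last => /(_ isT).
by apply: h => //; rewrite cat_path /= b !(extends_path pq).
Qed.

(** Builder joins a fresh vertex to the head of the path. Blue gains a vertex in one of the two
    rounds budgeted for it; red makes the fresh vertex a one-vertex [P] and the old path a [Q]
    without gap. *)
Lemma plain_step n k : 1 < n ->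
  (forall j, j < k -> plain_wins n j) -> (forall j, j < k -> locked_wins n j) ->
  plain_wins n k.
Proof.
move=> n1 IHp IHl p x s ps us le.
have [Nn|nN] := leqP n (size (x :: s)).
  by apply: blue_path_wins ps us _; lia.
case: k IHp IHl le => [|k] IHp IHl le; first by move: le nN => /=; lia.
have [y yf] := fresh_vertex (x :: s).
have yx : y != x by apply: contra yf => /eqP->; rewrite mem_head.
apply: (builder_plays yx) => q pq c.
  apply: (IHl k _ q y [::] x s [::]) => //; rewrite ?cats0 //=.
  - exact: extends_path ps.
  - by move: us yf => /= -> ->.
  - by move: le => /=; lia.
apply: (IHp k _ q y (x :: s)) => //.
- by rewrite /= c (extends_path pq).
- by rewrite cons_uniq yf.
- by move: le => /=; lia.
Qed.

Lemma insert_step n k : 1 < n ->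
  (forall j, j < k -> plain_wins n j) -> (forall j, j < k -> insert_wins n j) ->
  insert_wins n k.
Proof.
move=> n1 IHp IHi p z s d u pz pd un s0 r1 r2 k0 le.
have zc : z != last z s.
  case: s s0 un {pz r1 le} => // a s _.
  rewrite cat_cons cons_uniq mem_cat negb_or => /andP[/andP[zas _] _].
  by apply: contra zas => /eqP {1}->; rewrite /= mem_last.
have zd : z != d.
  by move: un => /=; rewrite mem_cat !inE !negb_or => /andP[/and3P[]].
have cd : last z s != d.
  apply/eqP => ed; move: un; rewrite cat_uniq => /and3P[_ /hasPn/(_ d)].
  by rewrite inE eqxx -ed mem_last => /(_ isT).
have f : forceable p (last z s) d by exists z.
have [Nn|nN] := leqP n (size ((z :: s) ++ d :: u)).
  case: k k0 {IHp IHi le} => // k _; apply: (builder_forces cd f) => q pq b.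
  apply: (@blue_path_wins _ _ _ z (s ++ d :: u)) => //; last by rewrite -cat_cons; lia.
  by rewrite cat_path /= b !(extends_path pq).
have k2 : 2 < k by lia.
case: k k2 IHp IHi le {k0} => [|[|k]] // k0 IHp IHi le.
have [y] := fresh_vertex ((z :: s) ++ d :: u).
rewrite mem_cat negb_or => /andP[yzs yu].
have zy : z != y by apply: contra yzs => /eqP<-; rewrite mem_head.
have cy : last z s != y by apply: contra yzs => /eqP<-; rewrite mem_last.
apply: (builder_plays zy) => q pq c.
  apply: (builder_forces cy); first by exists z; split=> //; apply: pq.
  move=> q' qq' b; have pq' := extends_trans pq qq'.
  apply: (IHi k _ q' z (rcons s y) d u) => //.
  - by rewrite rcons_path b (extends_path pq').
  - exact: extends_path pd.
  - rewrite (@perm_uniq _ _ (y :: (z :: s) ++ d :: u)); last by perm_count.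
    by rewrite cons_uniq un andbT mem_cat negb_or yzs.
  - by case: (s).
  - by rewrite last_rcons; apply: qq'.
  - exact: pq'.
  - by move: le; rewrite /= !size_cat /= size_rcons; lia.
apply: (builder_forces cd (forceable_extends pq f)) => q' qq' b.
have pq' := extends_trans pq qq'.
apply: (IHp k _ q' y (z :: s ++ d :: u)) => //.
- by rewrite /= cat_path /= b !(extends_path pq') //= andbT /blue colouredC; apply: qq'.
- by rewrite cons_uniq un andbT -cat_cons mem_cat negb_or yzs.
- by move: le => /=; lia.
Qed.

Lemma uniq_cat_neq (A B : seq nat) a b :
  uniq (A ++ B) -> a \in A -> b \in B -> a != b.
Proof.
rewrite cat_uniq => /and3P[_ /hasPn h _] aA bB.
by apply: contraNneq (h b bB) => <-.
Qed.

Lemma notin_neq (A : seq nat) a z : z \notin A -> a \in A -> a != z.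
Proof. by move=> zA aA; apply: contraNneq zA => <-. Qed.

Lemma locked_step n k : 2 < n ->
  (forall j, j < k -> locked_wins n j) -> (forall j, j < k -> insert_wins n j) ->
  locked_wins n k.
Proof.
move=> n2 IHl IHi p x s e t u px pe g un r an bn le.
have [z zf] := fresh_vertex ((x :: s) ++ (e :: t) ++ u).
have [zP zQ] : z \notin x :: s /\ z \notin (e :: t) ++ u.
  by move: zf; rewrite mem_cat negb_or => /andP.
have [uP uQ] : uniq (x :: s) /\ uniq ((e :: t) ++ u).
  by move: un; rewrite cat_uniq => /and3P[].
have xP : x \in x :: s by rewrite mem_head.
have lP : last x s \in x :: s by rewrite mem_last.
have eQ : e \in (e :: t) ++ u by rewrite mem_head.
have xe := uniq_cat_neq un xP eQ.
have le' := uniq_cat_neq un lP eQ.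
have xz := notin_neq zP xP; have lz := notin_neq zP lP; have ez := notin_neq zQ eQ.
have uzP : uniq (z :: x :: s) by rewrite cons_uniq zP.
have uzQ : uniq (z :: (e :: t) ++ u) by rewrite cons_uniq zQ.
(* If both paths lack one vertex, only two rounds are guaranteed. Joining [z] to [e] completes [Q]
   after blue, and after red forces [z x], which completes [P]. *)
have [/andP[/eqP a1 /eqP b1]|nsp] :=
  boolP (((size (x :: s)).+1 == n) && ((size ((e :: t) ++ u)).+1 == n)).
  have k2 : 1 < k by clear -a1 b1 le; lia.
  case: k k2 {IHl IHi le} => [|[|k]] // _.
  apply: (builder_plays ez) => q pq c.
    apply: (@builder_forces _ _ _ z x); first by rewrite eq_sym.
      by exists e; split=> //; rewrite 1?eq_sym // /red colouredC; apply: pq.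
    move=> q' qq' b; apply: (@blue_path_wins _ _ _ z (x :: s)) => //.
      by rewrite /= b (extends_path (extends_trans pq qq')).
    by rewrite /= in a1 *; clear -a1; lia.
  apply: (builder_closes_gap (extends_path pq pe) (gap_extends pq g)) => // q' qq' pq'.
  apply: (@blue_path_wins _ _ _ z (e :: t ++ u)) => //; last by rewrite /= in b1 *; clear -b1; lia.
  by rewrite /= pq' andbT /blue colouredC; apply: qq'.
have k3 : 2 < k by move: nsp an bn le; clear; lia.
case: k k3 IHl IHi le => [|[|[|k]]] // _ IHl IHi le.
apply: (builder_plays lz) => q pq c; last first.
  have pP : path (blue q) x (rcons s z) by rewrite rcons_path c (extends_path pq).
  have uP' : uniq (x :: rcons s z) by rewrite -rcons_cons rcons_uniq zP.
  have [aS|aS] := leqP n (size (x :: rcons s z)).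
    by apply: blue_path_wins pP uP' _; move: aS n2; clear; lia.
  apply: (IHl _ _ q x (rcons s z) e t u) => //.
  - exact: extends_path pe.
  - exact: gap_extends g.
  - rewrite (@perm_uniq _ _ (z :: (x :: s) ++ (e :: t) ++ u)); last by perm_count.
    by rewrite cons_uniq zf.
  - exact: pq.
  - by move: le; rewrite /= size_rcons; clear; lia.
have [s' [ps' ls' perm_s']] := blue_path_rev (extends_path pq px).
have := perm_size perm_s' => /= -[ss'].
(* Here only three rounds are guaranteed, and linking [P] to [e] would give just [n - 1] vertices.
   So [z] goes to the far end of [u]: red then forces a link of [P] with [u], on [2 * n - 4]
   vertices, where [s != [::]] ensures [4 <= n]. *)
have [sp|nsp2] := boolP [&& (size (x :: s)).+2 == n, (size ((e :: t) ++ u)).+1 == n,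
  t == [::] & s != [::]].
  move: sp => /and4P[/eqP a1 /eqP b1 /eqP t0 s0]; subst t.
  case: u g b1 un le zf zQ uQ bn eQ uzQ {nsp} => [|d u] g b1 un le zf zQ uQ bn eQ uzQ.
    by move: b1 a1 n2 s0; clear; case: s => //= *; lia.
  have dQ : last d u \in [:: e] ++ d :: u by rewrite inE mem_last orbT.
  have zd : z != last d u by rewrite eq_sym (notin_neq zQ dQ).
  apply: (builder_plays zd) => q' qq' c'; have pq' := extends_trans pq qq'.
    apply: (builder_forces (uniq_cat_neq un lP dQ)).
      exists z; split=> //; rewrite 1?eq_sym // /red colouredC; exact: qq'.
    move=> q2 qq2 b; have pq2 := extends_trans pq' qq2.
    have [_ pu] := g.
    have [u' [pu' _ perm_u']] := blue_path_rev (extends_path pq2 pu).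
    apply: (@blue_path_wins _ _ _ x (s ++ last d u :: u')).
    - by rewrite cat_path /= b pu' (extends_path pq2).
    - rewrite -cat_cons (@perm_uniq _ _ ((x :: s) ++ d :: u)); last by rewrite perm_cat2l.
      move: un; rewrite (@perm_uniq _ _ (e :: (x :: s) ++ d :: u)); last by perm_count.
      by rewrite cons_uniq => /andP[].
    - have := perm_size perm_u'; move: a1 b1 s0 n2; clear.
      by rewrite /= size_cat /=; case: s => //= *; lia.
  apply: (builder_closes_gap (extends_path pq' pe) (gap_extends pq' g)) => // q2 qq2 pq2.
  apply: (@blue_path_wins _ _ _ e (rcons (d :: u) z)).
  - by rewrite rcons_path (pq2 : path _ _ (d :: u)) /= /blue colouredC; apply: qq2.
  - by rewrite -rcons_cons rcons_uniq zQ.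
  - by move: b1; rewrite /= size_rcons; clear; lia.
have ze : z != e by rewrite eq_sym.
apply: (builder_plays ze) => q' qq' c'; have pq' := extends_trans pq qq'.
  case: (eqVneq s [::]) => [s0|s0].
    subst s; apply: (@red_triangle _ _ _ x z e) => //; [exact: qq'|exact: pq'].
  have fle : forceable q' (last x s) e.
    by exists z; split=> //; rewrite 1?eq_sym // /red colouredC; apply: qq'.
  have [abn|abn] := leqP n (size (x :: s) + size ((e :: t) ++ u)).
    apply: (builder_forces le' fle) => q2 qq2 b; have pq2 := extends_trans pq' qq2.
    (* With no round left for the gap, [P] followed by [e :: t] must already be long enough; it is,
       because the case [t = [::]] was treated separately. *)
    case: k IHl IHi le => [|k] IHl IHi le.
      apply: (@blue_path_wins _ _ _ x (s ++ e :: t)).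
      - by rewrite cat_path /= b !(extends_path pq2).
      - by move: un; rewrite catA cat_uniq => /and3P[].
      - have b1 : (size ((e :: t) ++ u)).+1 = n by move: le nsp an bn abn; clear; lia.
        have a1 : (size (x :: s)).+2 = n by move: le nsp an bn abn; clear; lia.
        move: nsp2; rewrite a1 b1 !eqxx s0 andbT /=; move: a1 n2; rewrite /= size_cat /=; clear.
        by case: t => //= *; lia.
    apply: (builder_closes_gap (extends_path pq2 pe) (gap_extends pq2 g)) => // q3 qq3 pq3.
    apply: (@blue_path_wins _ _ _ x (s ++ e :: t ++ u)) => //.
      rewrite cat_path /= pq3 (extends_path (extends_trans pq2 qq3)) //= andbT.
      exact: qq3.
    by move: abn n2; rewrite /= !size_cat /= !size_cat; clear; lia.
  have k2 : 1 < k.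
    by move: s0 an bn abn le n2; clear; case: s => //= *; lia.
  case: k k2 IHl IHi le => [|k] // k2 IHl IHi le.
  (* The paths are too short for linking them to win. Forcing [x z] through [e] leaves [z] red to
     the last vertex of [P] and to [e], the two sides of a new gap. The four rounds used fit the
     budget because [P] has at least two vertices. *)
  apply: (builder_forces xz).
    by exists e; split=> //; rewrite 1?eq_sym // /red colouredC //; apply: pq'.
  move=> q2 qq2 b; have pq2 := extends_trans pq' qq2.
  apply: (builder_closes_gap (extends_path pq2 pe) (gap_extends pq2 g)) => // q3 qq3 pq3.
  have pp3 := extends_trans pq2 qq3.
  apply: (IHi _ _ q3 z (x :: s) e (t ++ u)) => //.
  - by clear; lia.
  - by rewrite /= (extends_path pp3 px) andbT /blue colouredC; apply: qq3.
  - by rewrite -cat1s; move: zf un; rewrite /= => -> ->.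
  - by apply: (extends_trans qq' (extends_trans qq2 qq3)); rewrite /= -/(red _ _ _) /red colouredC.
  - exact: (extends_trans qq2 qq3).
  - move: le s0; rewrite /= !size_cat /= !size_cat; clear.
    by case: s => //= *; lia.
have pzQ : path (blue q') z (e :: t) by rewrite /= c' (extends_path pq').
have gz : gap q' z (e :: t) u := gap_extends pq' g.
have [bS|bS] := leqP n (size ((e :: t) ++ u)).+1.
  apply: (builder_closes_gap pzQ gz) => // q2 qq2 pq2.
  by apply: blue_path_wins pq2 uzQ _; move: bS n2 => /=; clear; lia.
(* The red edge from [z] to the last vertex of [P] replaces [x e], so [P] is reversed. *)
apply: (IHl _ _ q' (last x s) s' z (e :: t) u) => //.
- exact: extends_path ps'.
- rewrite (@perm_uniq _ _ (z :: (x :: s) ++ (e :: t) ++ u)); first by rewrite cons_uniq zf.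
  apply/permP => f; have := permP perm_s' f; rewrite /= !count_cat /= !count_cat; clear; lia.
- exact: qq'.
- by rewrite /= ss'.
- by move: le; rewrite /= ss'; clear; lia.
Qed.

Lemma plain_locked_insert_win n k : 2 < n ->
  [/\ plain_wins n k, locked_wins n k & insert_wins n k].
Proof.
move=> n2; elim/ltn_ind: k => k IH.
have IHp j : j < k -> plain_wins n j by move=> /IH[].
have IHl j : j < k -> locked_wins n j by move=> /IH[].
have IHi j : j < k -> insert_wins n j by move=> /IH[].
by split; [apply: plain_step|apply: locked_step|apply: insert_step] => //; lia.
Qed.

(** * The opening, where one further round is saved *)

(** The budget is one round below that of [plain_wins]. A red answer to [x y] forces [y] onto the
    other end and keeps the ends joined in red, at two rounds per vertex; the first blue answer
    gains a vertex in one round and so repays the debt. *)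
Lemma red_closed_path_wins n k p x s : 2 < n -> path (blue p) x s ->
  uniq (x :: s) -> s <> [::] -> red p x (last x s) ->
  3 * n <= k + 2 * size (x :: s) + 2 -> builder_wins n k p.
Proof.
move=> n2; elim/ltn_ind: k p x s => k IH p x s ps us s0 r le.
have [Nn|nN] := leqP n (size (x :: s)).
  by apply: blue_path_wins ps us _; lia.
have k2 : 1 < k by clear -le nN n2; lia.
case: k k2 IH le => [|[|k]] // _ IH le.
have xl : x != last x s.
  case: s s0 us {ps r le nN} => // a s _ /= /andP[xas _].
  by apply: contra xas => /eqP->; rewrite mem_last.
have [y yf] := fresh_vertex (x :: s).
have xy := notin_neq yf (mem_head x s).
have ly := notin_neq yf (mem_last x s).
apply: (builder_plays xy) => q pq c.
  apply: (builder_forces ly); first by exists x; split=> //; apply: pq.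
  move=> q' qq' b; apply: (IH _ _ q' x (rcons s y)) => //.
  - by rewrite rcons_path b (extends_path (extends_trans pq qq')).
  - by rewrite -rcons_cons rcons_uniq yf.
  - by case: (s).
  - by rewrite last_rcons; apply: qq'.
  - by move: le; rewrite /= size_rcons; clear; lia.
have [plain _ _] := plain_locked_insert_win k.+1 n2.
apply: (plain q y (x :: s)); rewrite ?cons_uniq ?yf //.
  by rewrite /= (extends_path pq) // andbT /blue colouredC.
by move: le => /=; clear; lia.
Qed.

(* The budgets here and in [double_wins] are one round short of [locked_wins].
   The round is recovered because no gap has been opened yet, and as long as
   none is, [Q] never gets ahead of [P]. *)
Definition single_wins n k := forall p x s e t,
  path (blue p) x s -> path (blue p) e t -> uniq ((x :: s) ++ e :: t) ->
  red p x e -> size (e :: t) < size (x :: s) < n ->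
  3 * n <= k + size (x :: s) + 2 * size (e :: t) + 2 -> builder_wins n k p.

Definition double_wins n k := forall p x s e t,
  path (blue p) x s -> path (blue p) e t -> uniq ((x :: s) ++ e :: t) ->
  red p x e -> red p (last x s) (last e t) ->
  size (e :: t) <= size (x :: s) -> (size (x :: s)).+1 < n ->
  3 * n <= k + size (x :: s) + 2 * size (e :: t) + 2 -> builder_wins n k p.

(** After a red answer the last vertex of [P] is red to both [z] and the last vertex of [Q]. Thus
    [Q] gains [z] across a gap in one round instead of two, which recovers the missing round. *)
Lemma double_step n k : 2 < n ->
  (forall j, j < k -> single_wins n j) -> double_wins n k.
Proof.
move=> n2 IHs p x s e t px pe un r r' ba an le.
case: k IHs le => [|k] IHs le; first by clear -an ba le n2; lia.
have [z zf] := fresh_vertex ((x :: s) ++ e :: t).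
have [zP zQ] : z \notin x :: s /\ z \notin e :: t.
  by move: zf; rewrite mem_cat negb_or => /andP.
have lz := notin_neq zP (mem_last x s).
have uz : uniq (z :: (x :: s) ++ e :: t) by rewrite cons_uniq zf.
have lez := notin_neq zQ (mem_last e t).
have ll := uniq_cat_neq un (mem_last x s) (mem_last e t).
apply: (builder_plays lz) => q pq c; last first.
  apply: (IHs _ _ q x (rcons s z) e t) => //.
  - by rewrite rcons_path c (extends_path pq).
  - exact: extends_path pe.
  - by rewrite (@perm_uniq _ _ (z :: (x :: s) ++ e :: t)) //; perm_count.
  - exact: pq.
  - by move: ba an; rewrite /= size_rcons; clear; lia.
  - by move: le; rewrite /= size_rcons; clear; lia.
have [s' [ps' _ perm_s']] := blue_path_rev (extends_path pq px).
have [t' [pt' _ perm_t']] := blue_path_rev (extends_path pq pe).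
have := perm_size perm_s'; have := perm_size perm_t' => /= -[st'] [ss'].
have [_ locked _] := plain_locked_insert_win k n2.
apply: (locked q (last x s) s' z [::] (last e t :: t')) => //.
- split=> //; exists (last x s); split=> //; exact: pq.
- rewrite (@perm_uniq _ _ (z :: (x :: s) ++ e :: t)) //.
  apply/permP => f; have := permP perm_s' f; have := permP perm_t' f.
  by rewrite /= !count_cat /=; clear; lia.
- by rewrite /= ss'; move: an; clear => /=; lia.
- by rewrite /= st'; move: ba an; clear => /=; lia.
- by rewrite /= st' ss'; move: le; clear => /=; lia.
Qed.

Lemma single_step n k : 2 < n ->
  (forall j, j < k -> single_wins n j) -> (forall j, j < k -> double_wins n j) ->
  single_wins n k.
Proof.
move=> n2 IHs IHd p x s e t px pe un r /andP[ba an] le.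
have k3 : 3 <= k by clear -ba an le; lia.
case: k k3 IHs IHd le => [|[|[|k]]] // _ IHs IHd le.
have [z zf] := fresh_vertex ((x :: s) ++ e :: t).
have [zP zQ] : z \notin x :: s /\ z \notin e :: t.
  by move: zf; rewrite mem_cat negb_or => /andP.
have uz : uniq (z :: (x :: s) ++ e :: t) by rewrite cons_uniq zf.
have uP : uniq (x :: s) by move: un; rewrite cat_uniq => /and3P[].
have xz := notin_neq zP (mem_head x s).
have ez := notin_neq zQ (mem_head e t).
have xe := uniq_cat_neq un (mem_head x s) (mem_head e t).
have lz := notin_neq zP (mem_last x s).
have lez := notin_neq zQ (mem_last e t).
have ll := uniq_cat_neq un (mem_last x s) (mem_last e t).
(* When [P] lacks one vertex, [z] is joined to [x]: blue wins, and red opens a gap between [z] and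
   [e]. *)
have [/eqP a1|a1] := boolP ((size (x :: s)).+1 == n).
  apply: (builder_plays xz) => q pq c.
    have [_ locked _] := plain_locked_insert_win k.+2 n2.
    apply: (locked q x s z [::] (e :: t)) => //.
    - exact: extends_path px.
    - split; [exists x; split=> //; exact: pq|exact: extends_path pe].
    - by rewrite (@perm_uniq _ _ (z :: (x :: s) ++ e :: t)) //; perm_count.
    - by move: ba a1; clear => /=; lia.
    - by move: le; clear => /=; lia.
  apply: (@blue_path_wins _ _ _ z (x :: s)); last by rewrite /= in a1 *; clear -a1; lia.
    by rewrite /= (extends_path pq) // andbT /blue colouredC.
  by rewrite cons_uniq zP.
have {a1}an : (size (x :: s)).+1 < n by move: a1 an; clear; lia.
apply: (builder_plays lz) => q pq c; last first.
  apply: (IHs _ _ q x (rcons s z) e t) => //.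
  - by rewrite rcons_path c (extends_path pq).
  - exact: extends_path pe.
  - by rewrite (@perm_uniq _ _ (z :: (x :: s) ++ e :: t)) //; perm_count.
  - exact: pq.
  - by move: ba an; rewrite /= size_rcons; clear; lia.
  - by move: le; rewrite /= size_rcons; clear; lia.
rewrite eq_sym in lez; apply: (builder_plays lez) => q' qq' c'.
  have pq' := extends_trans pq qq'.
  (* Linking the last vertices gives a path whose ends are joined by the red edge [x e], but its
     budget requires three vertices in [P]. For two, [Q] is the vertex [e] alone and [z] serves as
     insertion vertex. *)
  have [a2|a2] := leqP (size (x :: s)) 2.
    have t0 : t = [::] by apply: size0nil; move: a2 ba; clear => /=; lia.
    subst t; apply: (builder_forces xz).
      by exists e; split=> //; rewrite 1?eq_sym // /red colouredC //; apply: pq'.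
    move=> q2 qq2 b; have pq2 := extends_trans pq' qq2.
    have [_ _ insert] := plain_locked_insert_win k n2.
    apply: (insert q2 z (x :: s) e [::]) => //.
    - by rewrite /= (extends_path pq2 px) andbT /blue colouredC.
    - by apply: (extends_trans qq' qq2); rewrite /= -/(red _ _ _) /red colouredC.
    - exact: qq2.
    - by move: le a2 n2 an ba; clear => /=; lia.
    - by move: le a2 ba; rewrite /= size_cat; clear => /=; lia.
  apply: (builder_forces ll).
    by exists z; split=> //; rewrite 1?eq_sym // /red colouredC; apply: qq'.
  move=> q2 qq2 b; have pq2 := extends_trans pq' qq2.
  have [t' [pt' lt' perm_t']] := blue_path_rev (extends_path pq2 pe).
  have := perm_size perm_t' => /= -[st'].
  apply: (@red_closed_path_wins _ _ _ x (s ++ last e t :: t')) => //.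
  - by rewrite cat_path /= b pt' (extends_path pq2).
  - by rewrite -cat_cons (@perm_uniq _ _ ((x :: s) ++ e :: t)) // perm_cat2l.
  - by case: (s).
  - by rewrite last_cat /= lt'; apply: pq2.
  - by move: le a2; rewrite /= size_cat /= st'; clear; lia.
have pq' := extends_trans pq qq'.
apply: (IHd _ _ q' x s e (rcons t z)) => //.
- exact: extends_path px.
- by rewrite rcons_path (extends_path pq') //= /blue colouredC.
- by rewrite (@perm_uniq _ _ (z :: (x :: s) ++ e :: t)) //; perm_count.
- exact: pq'.
- by rewrite last_rcons; apply: qq'.
- by move: ba; rewrite /= size_rcons; clear; lia.
- by move: le; rewrite /= size_rcons; clear; lia.
Qed.

Lemma online_ramsey_le_linear n : 2 < n -> online_ramsey_le n (3 * n - 4).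
Proof.
move=> n2; have double k : double_wins n k.
  suff [] : single_wins n k /\ double_wins n k by [].
  elim/ltn_ind: k => k IH.
  have IHs j : j < k -> single_wins n j by move=> /IH[].
  have IHd j : j < k -> double_wins n j by move=> /IH[].
  by split; [apply: single_step|apply: double_step].
rewrite /online_ramsey_le; have -> : 3 * n - 4 = (3 * n - 5).+1 by lia.
(* Both answers to the first edge leave exactly the budget needed: one vertex in each path after
   red, a path on two vertices after blue. *)
apply: (@builder_plays _ _ _ 0 1) => // q _ c.
  by apply: (double _ q 0 [::] 1 [::]) => //=; lia.
have [plain _ _] := plain_locked_insert_win (3 * n - 5) n2.
by apply: (plain q 0 [:: 1]) => //=; [rewrite c|lia].
Qed.

(** * Painter *)

Section Weights.
Local Open Scope ring_scope.
Variable R : realType.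
Notation phi := (golden_ratio R).

Lemma golden_ratio_sqr : phi * phi = phi + 1.
Proof.
have : Num.sqrt (5 : R) ^+ 2 = 5 by rewrite sqr_sqrtr.
rewrite /golden_ratio; set r := Num.sqrt _ => r2.
have -> : (1 + r) / 2 * ((1 + r) / 2) = (1 + 2 * r + r ^+ 2) / 4 by field.
by rewrite r2; field.
Qed.

Lemma golden_ratio_gt : 3 / 2 < phi.
Proof.
have : Num.sqrt (5 : R) ^+ 2 = 5 by rewrite sqr_sqrtr.
have : 0 <= Num.sqrt (5 : R) by exact: sqrtr_ge0.
rewrite /golden_ratio; set r := Num.sqrt _ => r0 r2.
have : 2 < r by nra.
by lra.
Qed.

(** The first two inequalities are the goal; the mixed ones are carried along so that one of the two
    gluings always preserves all four. *)
Definition balanced (x y : R) := [/\ 2 - 2 * phi <= x, 2 - 2 * phi <= y,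
  1 <= x + phi * y & 1 <= phi * x + y].

Lemma balancedC x y : balanced x y -> balanced y x.
Proof. by case=> hx hy h1 h2; split=> //; rewrite addrC. Qed.

Lemma balanced_le x y x' y' : x <= x' -> y <= y' ->
  balanced x y -> balanced x' y'.
Proof.
have g := golden_ratio_gt.
move=> xx yy [hx hy h1 h2].
have gx : phi * x <= phi * x' by rewrite ler_pM2l //; lra.
have gy : phi * y <= phi * y' by rewrite ler_pM2l //; lra.
by split; lra.
Qed.

(** Red gluing keeps the mixed inequalities by addition, so it fails only if a glued side drops
    below [2 - 2 * phi]. Then both weights on that side are negative, and a mixed inequality
    multiplied by [phi] pays for the 1 lost by blue gluing. *)
Lemma balanced_merge x y z w : balanced x y -> balanced z w ->
  balanced (x + w) (y + z) \/ balanced (x + z - 1) (y + w).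
Proof.
have g := golden_ratio_gt; have g2 := golden_ratio_sqr.
have g0 : 0 < phi by lra.
move=> [hx hy h1 h2] [hz hw h3 h4].
have [xw|xw] := leP (2 - 2 * phi) (x + w).
  have [yz|yz] := leP (2 - 2 * phi) (y + z).
    by left; split; rewrite ?mulrDr; lra.
  right.
  have gy : phi * y <= 0 by rewrite pmulr_rle0 //; lra.
  have gz : phi * z <= 0 by rewrite pmulr_rle0 //; lra.
  have gx : 0 <= phi * (x + phi * y - 1) by rewrite mulr_ge0 //; lra.
  have e : phi * (phi * y) = phi * y + y by rewrite mulrA g2 mulrDl mul1r.
  by split; rewrite ?mulrDr ?mulrN ?mulr1 ?mulrDr ?mulrN ?mulr1 ?e in gx *; lra.
right.
have gx : phi * x <= 0 by rewrite pmulr_rle0 //; lra.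
have gw : phi * w <= 0 by rewrite pmulr_rle0 //; lra.
have gz : 0 <= phi * (z + phi * w - 1) by rewrite mulr_ge0 //; lra.
have e : phi * (phi * w) = phi * w + w by rewrite mulrA g2 mulrDl mul1r.
by split; rewrite ?mulrDr ?mulrN ?mulr1 ?mulrDr ?mulrN ?mulr1 ?e in gz *; lra.
Qed.

(** The second component is a single vertex. Red works down to [y = 1 - phi], where the glued side
    meets its lower bound; below that, [phi * (phi - 1) = 1] makes blue work. *)
Lemma balanced_leaf x y : balanced x y ->
  balanced (x + 1) (y + (1 - phi)) \/ balanced (x + (1 - phi) - 1) (y + 1).
Proof.
have g := golden_ratio_gt; have g2 := golden_ratio_sqr.
have g0 : 0 < phi by lra.
move=> [hx hy h1 h2].
have [y1|y1] := leP (1 - phi) y.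
  by left; split; rewrite ?mulrDr ?mulrN ?mulr1 ?g2; lra.
right.
have gy : 0 <= phi * (1 - phi - y) by rewrite mulr_ge0 //; lra.
have gx : 0 <= phi * (x + phi * y - 1) by rewrite mulr_ge0 //; lra.
have e : phi * (phi * y) = phi * y + y by rewrite mulrA g2 mulrDl mul1r.
by split; rewrite ?mulrDr ?mulrN ?mulr1 ?mulrDr ?mulrN ?mulr1 ?e ?g2 in gx gy *; lra.
Qed.

Definition leaf_or_balanced (x y : R) := balanced x y \/ x = 1 - phi /\ y = 1.

Lemma painter_choice x y z w : leaf_or_balanced x y -> leaf_or_balanced z w ->
  balanced (x + w) (y + z) \/ balanced (x + z - 1) (y + w).
Proof.
case=> [b1|[-> ->]] [b2|[-> ->]].
- exact: balanced_merge.
- exact: balanced_leaf.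
- have [/balancedC h|h] := balanced_leaf b2; [left|right].
    by rewrite (addrC _ w) (addrC _ z).
  by rewrite (addrC _ z) (addrC _ w).
- left; have g := golden_ratio_gt; have g2 := golden_ratio_sqr.
  by split; rewrite ?mulrDr ?mulrN ?mulr1 ?g2; lra.
Qed.

End Weights.

(** * The bipartition maintained by Painter *)

Section Painter.
Variable R : realType.
Notation phi := (golden_ratio R).

Section Labelling.
Variables (p : position) (N : nat) (c : nat -> nat) (s : nat -> bool).

Definition side_vertices l b :=
  count (fun w => (c w == l) && (s w == b)) (iota 0 N).

(** Testing the first endpoint is enough: in a consistent labelling both ends of an edge have the
    same label, and those of a blue edge also the same side. *)
Definition outer_edges l b :=
  count (fun t => (c t.1.1 == l) && (t.2 || (s t.1.1 != b))) p.

Definition weight l b : R :=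
  ((outer_edges l b)%:R + 1 - phi * (side_vertices l b)%:R)%R.

(** [c] names components and [s] sides. The bound [N] makes the counts finite; vertices from [N] on
    are untouched and label themselves. *)
Definition consistent := [/\
  forall t, t \in p -> [/\ t.1.1 < N, c t.1.1 = c t.1.2 & (s t.1.1 != s t.1.2) = t.2],
  forall w, N <= w -> c w = w & forall w, w < N -> c w < N].

Definition isolated w := [/\ forall w', c w' = c w -> w' = w,
  weight (c w) (s w) = (1 - phi)%R & weight (c w) (~~ s w) = 1%R].

(* A single vertex has weights [1 - phi] and [1], which are not balanced. *)
Definition healthy w := balanced (weight (c w) true) (weight (c w) false) \/ isolated w.

End Labelling.

Definition painter_inv p N c s :=
  consistent p N c s /\ forall w, w < N -> healthy p N c s w.

Lemma painter_inv_nil : painter_inv [::] 0 id xpredT.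
Proof. by split=> //; split. Qed.

Lemma painter_inv_widen p N M c s : N <= M ->
  painter_inv p N c s -> painter_inv p M c s.
Proof.
move=> NM [[hp hge hlt] hh].
have cM w : w < M -> c w < M.
  move=> wM; have [/hge-> //|/hlt cw] := leqP N w; exact: leq_trans NM.
have old w b : w < N -> side_vertices M c s (c w) b = side_vertices N c s (c w) b.
  move=> wN; rewrite /side_vertices -(subnKC NM) iotaD add0n count_cat.
  rewrite [X in _ + X](@eq_in_count _ _ pred0) ?count_pred0 ?addn0 // => w'.
  rewrite mem_iota => /andP[Nw' _]; rewrite (hge w' Nw').
  by case: eqP (hlt w wN) => // <-; rewrite ltnNge Nw'.
split.
  split=> //.
  - by move=> t /hp[t1 t2 t3]; split=> //; apply: leq_trans NM.
  - by move=> w Mw; apply: hge; apply: leq_trans Mw.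
move=> w wM; have [Nw|wN] := leqP N w; last first.
  case: (hh w wN) => [b|[i1 i2 i3]]; [left|right].
    by rewrite /weight !old.
  by split=> //; rewrite /weight old.
have cw := hge w Nw.
have uniq_w w' : c w' = c w -> w' = w.
  rewrite cw; have [/hge-> //|/hlt cw' e] := leqP N w'.
  by move: Nw; rewrite -e leqNgt cw'.
have o0 b : outer_edges p c s (c w) b = 0.
  rewrite /outer_edges (@eq_in_count _ _ pred0) ?count_pred0 // => t /hp[t1 _ _].
  apply/negbTE; rewrite negb_and; apply/orP; left; apply/eqP => /uniq_w e.
  by move: t1; rewrite e ltnNge Nw.
have v1 b : side_vertices M c s (c w) b = (s w == b).
  rewrite /side_vertices (@eq_count _ _ (fun w' => (w' == w) && (s w == b))).
    case: (s w == b); last first.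
      by rewrite (@eq_count _ _ pred0) ?count_pred0 // => i; rewrite andbF.
    rewrite (@eq_count _ _ (pred1 w)); last by move=> i; rewrite andbT.
    by rewrite count_uniq_mem ?iota_uniq // mem_iota /= add0n wM.
  move=> w' /=; have [->|ww] := eqVneq w' w; first by rewrite eqxx.
  by rewrite (negbTE (_ : c w' != c w)) //; apply: contraNneq ww => /uniq_w ->.
right; split=> //; rewrite /weight o0 v1 ?eqxx; first by rewrite mulr1 add0r.
have -> : (s w == ~~ s w) = false by case: (s w).
by rewrite mulr0 subr0 add0r.
Qed.

Lemma balanced_sides p N c s l b :
  balanced (weight p N c s l b) (weight p N c s l (~~ b)) <->
  balanced (weight p N c s l true) (weight p N c s l false).
Proof. by case: b => //; split=> /balancedC. Qed.

Lemma healthy_leaf p N c s w : healthy p N c s w ->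
  leaf_or_balanced (weight p N c s (c w) (s w)) (weight p N c s (c w) (~~ s w)).
Proof.
case=> [b|[_ wl wr]]; last by right.
by left; apply: (balanced_sides p N c s (c w) (s w)).2.
Qed.

(** Such an edge can only raise the weights of its component, and it never meets an isolated
    vertex. *)
Lemma painter_inner p N c s u v : painter_inv p N c s -> u < N -> v < N ->
  u != v -> c u = c v -> painter_inv (((u, v), s u != s v) :: p) N c s.
Proof.
move=> [[hp hge hlt] hh] uN vN uv cuv.
have outerE l b : outer_edges (((u, v), s u != s v) :: p) c s l b =
    ((c u == l) && ((s u != s v) || (s u != b))) + outer_edges p c s l b by [].
split; first by split=> // t; rewrite inE => /predU1P[->|/hp].
move=> w wN; case: (hh w wN) => [b|[i1 i2 i3]].
  left; apply: balanced_le b; rewrite /weight outerE natrD lerD2r lerD2r;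
  by rewrite lerDr ler0n.
have cuw : (c u == c w) = false.
  apply/eqP => e; case/eqP: uv; rewrite (i1 u e) (i1 v) //; by rewrite -cuv.
by right; split=> //; rewrite /weight outerE cuw.
Qed.

(* The component of [v] is absorbed by that of [u]; its sides are swapped or not
   according to the colour [k] of the new edge. *)
Lemma painter_outer p N c s u v : painter_inv p N c s -> u < N -> v < N ->
  c u <> c v -> exists k c' s', painter_inv (((u, v), k) :: p) N c' s'.
Proof.
move=> [[hp hge hlt] hh] uN vN cuv.
pose c' w := if c w == c v then c u else c w.
(* The flip is chosen so that [u] and [v] end on different sides exactly when [k] is red; [b'] below
   translates a new side back to the old side in the component of [v]. *)
pose s' k w := if c w == c v then s w (+) (s v (+) s u (+) k) else s w.
have c'u : c' u = c u by rewrite /c'; case: eqP.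
have s'u k : s' k u = s u by rewrite /s'; case: eqP.
have c'v : c' v = c u by rewrite /c' eqxx.
have c'old w : c' w <> c u -> c' w = c w /\ forall k, s' k w = s w.
  by rewrite /c' /s'; case: eqP.
have c'E l w : l <> c u -> l <> c v -> (c' w == l) = (c w == l).
  rewrite /c'; case: (eqVneq (c w) (c v)) => // -> lu lv.
  by case: eqP => [/esym/lu //|_]; case: eqP => [/esym/lv //|].
have s'E l w k : l <> c u -> l <> c v -> c' w = l -> s' k w = s w.
  by move=> lu lv e; apply: (c'old w _).2; rewrite e.
pose b' k b := b (+) (s v (+) s u (+) k).
have vertE k b : side_vertices N c' (s' k) (c u) b =
    side_vertices N c s (c u) b + side_vertices N c s (c v) (b' k b).
  rewrite /side_vertices -count_predUI [X in _ + X](@eq_count _ _ pred0).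
    rewrite count_pred0 addn0; apply: eq_count => w; rewrite /c' /s' /b' /=.
    have [->|e] := eqVneq (c w) (c v); last by rewrite orbF.
    rewrite eqxx /= (_ : (c v == c u) = false) /=; last by apply/eqP => /esym.
    by case: (s w) (s v) (s u) k b => [] [] [] [] [].
  by move=> w /=; case: (eqVneq (c w) (c u)) => // ->; rewrite (introF eqP cuv) andbF.
have outE k b : outer_edges p c' (s' k) (c u) b =
    outer_edges p c s (c u) b + outer_edges p c s (c v) (b' k b).
  rewrite /outer_edges -count_predUI [X in _ + X](@eq_count _ _ pred0).
    rewrite count_pred0 addn0; apply: eq_count => -[[w w1] col]; rewrite /c' /s' /b' /=.
    have [->|e] := eqVneq (c w) (c v); last by rewrite orbF.
    rewrite eqxx /= (_ : (c v == c u) = false) /=; last by apply/eqP => /esym.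
    by case: col (s w) (s v) (s u) k b => [] [] [] [] [] [].
  by move=> t /=; case: (eqVneq (c t.1.1) (c u)) => // ->; rewrite (introF eqP cuv) andbF.
(* Adding two weights counts the constant 1 twice; the new edge makes up for this unless it is blue
   and inside side [b]. *)
have weightE k b : weight (((u, v), k) :: p) N c' (s' k) (c u) b =
    (weight p N c s (c u) b + weight p N c s (c v) (b' k b)
      - (~~ (k || (s u != b)))%:R)%R.
  rewrite /weight vertE.
  have -> : outer_edges (((u, v), k) :: p) c' (s' k) (c u) b =
    (k || (s u != b)) + outer_edges p c' (s' k) (c u) b.
    by rewrite {1}/outer_edges /= c'u eqxx s'u.
  rewrite outE !natrD; case: (k || _) => /=; ring.
have weight_old k l b : l <> c u -> l <> c v ->
    weight (((u, v), k) :: p) N c' (s' k) l b = weight p N c s l b.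
  move=> lu lv; rewrite /weight; congr (_%:R + _ - _ * _%:R)%R.
    rewrite /outer_edges /= c'u (_ : (c u == l) = false) /=; last by apply/eqP => /esym.
    rewrite add0n; apply: eq_count => t.
    by rewrite -(c'E l _ lu lv); case: eqP => // /(s'E _ _ k lu lv)->.
  by apply: eq_count => w; rewrite -(c'E l _ lu lv); case: eqP => // /(s'E _ _ k lu lv)->.
have [k bal] : exists k, balanced (weight (((u, v), k) :: p) N c' (s' k) (c u) (s u))
    (weight (((u, v), k) :: p) N c' (s' k) (c u) (~~ s u)).
  have := painter_choice (healthy_leaf (hh u uN)) (healthy_leaf (hh v vN)).
  case=> bal; [exists true|exists false]; move: bal; rewrite !weightE /b' eqxx /=.
    rewrite !subr0; congr (balanced (_ + weight _ _ _ _ _ _) (_ + weight _ _ _ _ _ _));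
    by case: (s u) (s v) => [] [].
  have -> : (s u == ~~ s u) = false by case: (s u).
  rewrite /= subr0; congr (balanced (_ + weight _ _ _ _ _ _ - _) (_ + weight _ _ _ _ _ _));
  by case: (s u) (s v) => [] [].
exists k, c', (s' k); split.
  split.
  - move=> t; rewrite inE => /predU1P[->|/hp[t1 t2 t3]]; split=> //=.
    + by rewrite c'u c'v.
    + rewrite s'u /s' eqxx; move: (s u) (s v) k {bal}; clear.
      by case=> [] [] [].
    + by rewrite /c' t2.
    + rewrite /s' -t2; case: (c t.1.1 == c v) => //; rewrite -t3.
      move: (s t.1.1) (s t.1.2) (s v) (s u) k {bal t3}; clear.
      by case=> [] [] [] [] [].
  - move=> w Nw; rewrite /c' (hge w Nw); case: eqP => // e.
    by move: (hlt v vN); rewrite -e ltnNge Nw.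
  - by move=> w wN; rewrite /c'; case: eqP => _; exact: hlt.
move=> w wN; have [e|/eqP ne] := eqVneq (c' w) (c u).
  by left; rewrite e; exact: (balanced_sides _ N c' (s' k) (c u) (s u)).1.
have [cw sw] := c'old w ne.
have nv : c w <> c v by move: cw ne; rewrite /c'; case: eqP => // _ <-.
have nu : c w <> c u by rewrite -cw.
case: (hh w wN) => [b|[i1 i2 i3]]; [left|right].
  by rewrite !cw !weight_old.
split; rewrite cw ?sw ?weight_old //.
move=> w' /eqP; rewrite c'E // => /eqP; exact: i1.
Qed.

Lemma painter_answers p N c s u v : painter_inv p N c s -> u <> v ->
  exists k N' c' s', painter_inv (((u, v), k) :: p) N' c' s'.
Proof.
move=> inv uv; pose M := maxn N (maxn u v).+1.
have {inv}inv : painter_inv p M c s by apply: painter_inv_widen inv; rewrite /M; lia.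
have uM : u < M by rewrite /M; lia.
have vM : v < M by rewrite /M; lia.
have [cuv|/eqP cuv] := eqVneq (c u) (c v).
  by exists (s u != s v), M, c, s; apply: painter_inner => //; apply/eqP.
by have [k [c' [s' h]]] := painter_outer inv uM vM cuv; exists k, M, c', s'.
Qed.

(** * Counting edges at the end of the game *)

(** By induction: the first edge contains [x], hence is not among the edges inside the rest of the
    path. *)
Lemma blue_path_edges p x t : uniq (x :: t) -> path (blue p) x t ->
  size t <= count (fun e => [&& ~~ e.2, e.1.1 \in x :: t & e.1.2 \in x :: t]) p.
Proof.
elim: t x => [|y t IH] x // ux /= /andP[bxy py].
have uy : uniq (y :: t) by case/andP: ux.
have {}ux : x \notin y :: t by case/andP: ux.
pose first_edge e := same_edge e.1 x y && (e.2 == false).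
pose inside (e : nat * nat * bool) :=
  [&& ~~ e.2, e.1.1 \in y :: t & e.1.2 \in y :: t].
have lt0 : 0 < count first_edge p by rewrite -has_count.
have le0 : size t <= count inside p := IH y uy py.
apply: (@leq_trans (count first_edge p + count inside p)); first exact: (leq_add lt0 le0).
rewrite -count_predUI [X in _ + X](@eq_count _ _ pred0) => [|e /=].
  rewrite count_pred0 addn0; apply: sub_count => -[[a b] k] /=.
  rewrite /first_edge /inside /= /same_edge /= !inE.
  by move=> /orP[/andP[/orP[]/andP[/eqP-> /eqP->] /eqP->]|/and3P[-> /orP[]-> /orP[]->]];
    rewrite ?eqxx ?orbT.
apply/negbTE/negP => /andP[/andP[/orP[]/andP[/eqP e1 /eqP e2] _] /and3P[_]].
  by rewrite e1 (negbTE ux).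
by rewrite e2 (negbTE ux).
Qed.

(** Two sides admit no red triangle. A blue path stays on one side, so its [n - 1] edges are
    disjoint from the outer edges of that side, whose number the weight bounds from below. *)
Lemma painter_inv_over n p N c s : 1 < n -> painter_inv p N c s -> game_over n p ->
  ((phi + 1) * n%:R - 2 * phi <= (size p)%:R :> R)%R.
Proof.
move=> n1 [[hp hge hlt] hh] over.
have sideP k u v : coloured k p u v ->
    [/\ u < N, c u = c v & (s u != s v) = k].
  case/hasP=> t tp /andP[/orP[]/andP[/eqP<- /eqP<-] /eqP<-]; have [t1 t2 t3] := hp t tp => //.
  split=> //; last by rewrite eq_sym.
  rewrite ltnNge; apply/negP => Nt; have := hlt _ t1.
  by rewrite t2 (hge _ Nt) ltnNge Nt.
case: over => [[u [v [w [_ _ _ /and3P[/sideP[_ _ r1] /sideP[_ _ r2] /sideP[_ _ r3]]]]]]|].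
  by move: r1 r2 r3; case: (s u) (s v) (s w) => [] [] [].
move=> [x [t [st ut pt]]].
have hx y : y \in x :: t -> c y = c x /\ s y = s x.
  elim: t x y pt {st ut} => [|z t IH] x y /=; first by rewrite inE => _ /eqP->.
  move=> /andP[/sideP[_ cxz sxz] pz]; rewrite inE => /predU1P[-> //|yt].
  have [-> ->] := IH z y pz yt; split=> //.
  by apply/esym/eqP; rewrite -[_ == _]negbK sxz.
have hN y : y \in x :: t -> y < N.
  case: t st pt {ut hx} => [|z t] st; first by move: n1; rewrite -st.
  elim: t x z {st} => [|z' t IH] x z /= /andP[b].
    move=> _; rewrite !inE => /orP[]/eqP->; first by case: (sideP _ _ _ b).
    by move: b; rewrite /blue colouredC => /sideP[].
  move=> pz; rewrite inE => /predU1P[->|]; last exact: IH.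
  by case: (sideP _ _ _ b).
have xN : x < N by apply: hN; rewrite mem_head.
have vert : n <= side_vertices N c s (c x) (s x).
  rewrite /side_vertices -size_filter -st; apply: uniq_leq_size => // y yt.
  by have [cy sy] := hx y yt; rewrite mem_filter cy sy !eqxx mem_iota /= hN.
have edges : n.-1 + outer_edges p c s (c x) (s x) <= size p.
  rewrite -[size p](count_predC [pred t | (c t.1.1 == c x) && (t.2 || (s t.1.1 != s x))]).
  rewrite addnC leq_add2l -st /=; apply: leq_trans (blue_path_edges ut pt) _.
  apply: sub_count => e /and3P[e2 /hx[ce se] _] /=.
  by rewrite ce se eqxx /= negb_or e2 eqxx.
(* The second vertex of the path, present since [1 < n], shows that [x] is not isolated. *)
have bal : (2 - 2 * phi <= weight p N c s (c x) (s x))%R.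
  case: (hh x xN) => [/(balanced_sides p N c s (c x) (s x)).2[] //|[i1 _ _]].
  case: t st ut hx {pt hN} => [|y t] st; first by move: n1; rewrite -st.
  move=> /= /andP[/negP xy _] /(_ y); rewrite !inE eqxx orbT => /(_ isT)[cy _].
  by case: xy; rewrite (i1 y cy) mem_head.
have g := golden_ratio_gt R.
have : (phi * n%:R <= phi * (side_vertices N c s (c x) (s x))%:R)%R.
  by rewrite ler_pM2l ?ler_nat //; lra.
have : (n%:R + (outer_edges p c s (c x) (s x))%:R <= (size p)%:R + 1 :> R)%R.
  by rewrite -natrD natr1 ler_nat; lia.
by move: bal; rewrite /weight; lra.
Qed.

(** The sum of rounds played and rounds left is unchanged by a round, so the induction needs only a
    colour that keeps the invariant. *)
Lemma painter_survives n k p N c s : 1 < n -> painter_inv p N c s ->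
  builder_wins n k p -> ((phi + 1) * n%:R - 2 * phi <= (size p + k)%:R :> R)%R.
Proof.
move=> n1; elim: k p N c s => [|k IH] p N c s inv.
  by case=> // /(painter_inv_over n1 inv); rewrite addn0.
case=> [/(painter_inv_over n1 inv) h|[u [v [uv [_ h]]]]].
  by apply: le_trans h _; rewrite ler_nat leq_addr.
have [j [N' [c' [s' inv']]]] := painter_answers inv uv.
by have := IH _ _ _ _ inv' (h j); rewrite /= addSnnS.
Qed.

End Painter.

Theorem corollary1 (R : realType) (n : nat) : (3 <= n)%N ->
  online_ramsey_le n (3 * n - 4) /\
  (forall k : nat, online_ramsey_le n k ->
     (Num.ceil ((golden_ratio R + 1) * n%:R - 2 * golden_ratio R) <= k%:Z)%R).
Proof.
move=> n3; split; first exact: online_ramsey_le_linear.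
move=> k win; rewrite ceil_le_int -pmulrn.
by apply: painter_survives (painter_inv_nil R) win; lia.
Qed.
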